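(* Let $k=2$ and let $c_1\le c_2$ be real numbers. Consider the following scheme for $M(x)\partial_tu+\partial_xf(u)=\partial_x(A(x,u)\partial_xu)$ on a uniform mesh with periodic boundary conditions: given $u_h^n\in V_h$, find $u_h^{n+1}\in V_h$ such that for all $v\in V_h$ and $j=1,\dots,N$, $$\begin{aligned}\int_{I_j}M\,\frac{u_h^{n+1}-u_h^n}{\tau}v\,dx=&\int_{I_j}f(u_h^n)\partial_xv\,dx-\hat f\big((u_h^n)^-,(u_h^n)^+\big)v\Big|_{x_{j-\frac12}}^{x_{j+\frac12}}-\int_{I_j}A_h^n\,\partial_xu_h^n\,\partial_xv\,dx\\&+\{A_h^n\}\big[\widehat{\partial_xu_h^n}\,v+(u_h^n-\{u_h^n\})\partial_xv\big]\Big|_{x_{j-\frac12}}^{x_{j+\frac12}},\end{aligned}$$ with flux parameters satisfying $$\beta_0\ge1\quad\text{and}\quad\tfrac18\le\beta_1\le\tfrac14 .$$ Let $\gamma$ satisfy $$a_j<\gamma<b_j\ \ (j=1,\dots,N)\quad\text{and}\quad|\gamma|\le8\beta_1-1,$$ and set $S_j=x_j+\frac h2\{-1,\gamma,1\}$. Let $\lambda=\tau/h$, $\mu=\tau/h^2$ and assume the CFL conditions $\lambda\le\lambda_0$, $\mu\le\mu_0$, where $$\lambda_0=\frac1{2\mathcal L}\min_{1\le j\le N}\{\tilde\omega_j^1(\gamma),\tilde\omega_j^3(\gamma)\}=\frac1{2\mathcal L}\min_{1\le j\le N}\{\tilde\omega_j^1(\pm\gamma)\},$$ $$\mu_0=\frac12\Big(\max_{1\le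 j\le N}\{A_h^n\}_{j+\frac12}\Big)^{-1}\min_{1\le j\le N}\left\{\frac{\tilde\omega_j^1(\pm\gamma)}{\alpha_3(\mp\gamma)+\alpha_1(\pm\gamma)},\ \frac{\langle1-\xi^2\rangle_j}{4(1-4\beta_1)}\right\}$$ (minima being taken over both choices of sign). Then the scheme is maximum-principle-satisfying: if $u_h^n(x)\in[c_1,c_2]$ on $S_j$ for all $j=1,\dots,N$, then $\bar u_j^{n+1}\in[c_1,c_2]$ for all $j=1,\dots,N$.
   Context: Setting. $\Omega=\bigcup_{j=1}^NI_j$ is an interval partitioned into cells $I_j=[x_{j-\frac12},x_{j+\frac12}]$ of uniform length $h$ with midpoints $x_j$; periodic boundary conditions. $V_h=\{v\in L^2(\Omega):v|_{I_j}\in P^k(I_j),\ j=1,\dots,N\}$, $P^k$ being polynomials of degree at most $k$; $\tau>0$ is the time step. $M(x)>0$, $f$ is smooth, $A(x,u)\ge0$, $A_h^n=A(x,u_h^n)$. At a cell interface, $v^\mp$ are the left/right limits, $[v]=v^+-v^-$, $\{v\}=\frac12(v^++v^-)$; $\{A_h^n\}_{j+\frac12}$ is the average of $A_h^n$ at $x_{j+\frac12}$. In boundary terms on $\partial I_j$, $v$, $\partial_xv$ and the unbraced $u_h^n$ are traces from inside $I_j$. By periodicity left limits at $x_{\frac12}$ are those at $x_{N+\frac12}$ and right limits at $x_{N+\frac12}$ those at $x_{\frac12}$. Values of $u_h^n$ on $S_j$ are those of the polynomial $u_h^n|_{I_j}$ (one-sided limits from inside at endpoints). Diffusive flux at $x_{j+\frac12}$: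 $\widehat{\partial_xv}=\frac{\beta_0}h[v]+\{\partial_xv\}+\beta_1h[\partial_x^2v]$. Convective flux: $\hat f(u,v)$ is any monotone numerical flux, i.e. Lipschitz continuous (with Lipschitz constant $\mathcal L$), nondecreasing in $u$, nonincreasing in $v$, and consistent: $\hat f(u,u)=f(u)$. Averages. $\langle q(\xi)\rangle_j=\frac12\int_{-1}^1M(x_j+\frac h2\xi)q(\xi)\,d\xi$ for $q$ on $[-1,1]$; $\langle u_h\rangle_j=\frac1h\int_{I_j}Mu_h\,dx$; $\bar u_j=\langle u_h\rangle_j/\langle1\rangle_j$. Coefficients. $$a_j=\frac{\langle\xi-\xi^2\rangle_j}{\langle1-\xi\rangle_j},\qquad b_j=\frac{\langle\xi+\xi^2\rangle_j}{\langle1+\xi\rangle_j},$$ $$\tilde\omega_j^1(\gamma)=\frac{\langle\gamma-\xi(1+\gamma)+\xi^2\rangle_j}{2(1+\gamma)},\qquad\tilde\omega_j^3(\gamma)=\frac{\langle-\gamma+\xi(1-\gamma)+\xi^2\rangle_j}{2(1-\gamma)},$$ $$\alpha_1(\gamma)=\frac{8\beta_1-1+\gamma}{2(1+\gamma)},\qquad\alpha_3(\gamma)=\beta_0+\frac{8\beta_1-3+\gamma}{2(1-\gamma)},$$ and the values at $-\gamma$ are obtained by replacing $\gamma$ by $-\gamma$ in these formulas. A quotient with zero denominator in $\lambda_0$ or $\mu_0$ is read as $+\infty$ (no restriction).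
   Formalization: In μ0 the weight ω̃¹_j(−γ) is replaced by ω̃³_j(γ), and λ0 is given by its first expression only; the two weights differ by ⟨ξ⟩_j, so the asserted equality fails for general M, and with the literal weight the theorem is false. *)

(* Defs.v *)
(* MathComp-Analysis *)
From HB Require Import structures.
From mathcomp Require Export all_boot all_order all_algebra.
From mathcomp Require Export all_classical all_reals all_analysis.
Export numFieldNormedType.Exports.
Export Order.TTheory GRing.Theory Num.Theory.

Set Implicit Arguments.
Unset Strict Implicit.
Unset Printing Implicit Defensive.

Local Open Scope classical_set_scope.
Local Open Scope ring_scope.

Definition smooth (R : realType) (f : R -> R) : Prop :=
  forall (n : nat) (x : R), derivable (derive1n n f) x 1.

(* The Lipschitz constant is taken with respect to |u| + |v|; this is the same
   as being Lipschitz with constant Lip in each argument separately. *)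
Record monotone_flux (R : realType) (f : R -> R) (Lip : R)
    (fhat : R -> R -> R) : Prop := MonotoneFlux {
  flux_lipschitz : forall u v u' v' : R,
    `|fhat u v - fhat u' v'| <= Lip * (`|u - u'| + `|v - v'|);
  flux_nondecreasing : forall u u' v : R, u <= u' -> fhat u v <= fhat u' v;
  flux_nonincreasing : forall u v v' : R, v <= v' -> fhat u v' <= fhat u v;
  flux_consistent : forall u : R, fhat u u = f u }.

(* A quotient with zero denominator is read as +oo. *)
Definition equot (R : realType) (a : \bar R) (b : R) : \bar R :=
  if b == 0 then +oo%E else (a * (b^-1)%:E)%E.

Section Mesh.
Context {R : realType} {N : nat}.
(* xa is the left end of the domain, h the cell length.  Cells are numbered
   from 0: the cell j : 'I_N below is I_(j+1) in one-based numbering. *)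
Variables (xa h : R).
Implicit Types (j : 'I_N) (u v : 'I_N -> {poly R}).

Definition xleft j : R := xa + h * j%:R.
Definition xright j : R := xa + h * j.+1%:R.
Definition xmid j : R := (xleft j + xright j) / 2.
Definition cell j : set R := `[xleft j, xright j].
Definition domain : set R := `[xa, xa + h * N%:R].

(* Piecewise polynomials: v j is the polynomial, in the global variable x,
   which v coincides with on the cell j. *)
Definition in_Vh (k : nat) v : Prop := forall j, (size (v j) <= k.+1)%N.

Definition ddx v : 'I_N -> {poly R} := fun j => (v j)^`().

(* An index j used as an interface stands for the right end of the cell j; the
   left end of the cell j is the interface ord_pred j.  ordS and ord_pred are
   cyclic on 'I_N, so the two ends of the domain are one interface. *)
Definition lim_left v j : R := (v j).[xright j].
Definition lim_right v j : R := (v (ordS j)).[xleft (ordS j)].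
Definition jump v j : R := lim_right v j - lim_left v j.
Definition avg v j : R := (lim_left v j + lim_right v j) / 2.

Definition avgA (A : R -> R -> R) u j : R :=
  (A (xright j) (lim_left u j) + A (xleft (ordS j)) (lim_right u j)) / 2.

Definition diff_flux (beta0 beta1 : R) v j : R :=
  beta0 / h * jump v j + avg (ddx v) j + beta1 * h * jump (ddx (ddx v)) j.

Definition num_flux (fhat : R -> R -> R) u j : R :=
  fhat (lim_left u j) (lim_right u j).

(* The interface term {A} [ flux * v + (u - {u}) * dv/dx ], at the interface i
   located at the end x of the cell j; u, v and dv/dx without braces are traces
   from inside the cell j. *)
Definition diff_bnd (A : R -> R -> R) (beta0 beta1 : R) u v j (i : 'I_N)
    (x : R) : R :=
  avgA A u i * (diff_flux beta0 beta1 u i * (v j).[x]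
                + ((u j).[x] - avg u i) * (ddx v j).[x]).

Definition scheme (k : nat) (M f : R -> R) (A fhat : R -> R -> R)
    (beta0 beta1 tau : R) (u0 u1 : 'I_N -> {poly R}) : Prop :=
  forall v, in_Vh k v -> forall j,
    \int[lebesgue_measure]_(x in cell j)
       (M x * (((u1 j).[x] - (u0 j).[x]) / tau) * (v j).[x])
    = \int[lebesgue_measure]_(x in cell j) (f (u0 j).[x] * (ddx v j).[x])
      - (num_flux fhat u0 j * (v j).[xright j]
         - num_flux fhat u0 (ord_pred j) * (v j).[xleft j])
      - \int[lebesgue_measure]_(x in cell j)
          (A x (u0 j).[x] * (ddx u0 j).[x] * (ddx v j).[x])
      + (diff_bnd A beta0 beta1 u0 v j j (xright j)
         - diff_bnd A beta0 beta1 u0 v j (ord_pred j) (xleft j)).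

Section Weights.
Variable M : R -> R.

Definition bracket j (q : R -> R) : R :=
  2^-1 * \int[lebesgue_measure]_(xi in `[-1, 1])
           (M (xmid j + h / 2 * xi) * q xi).

Definition cell_mean u j : R :=
  h^-1 * \int[lebesgue_measure]_(x in cell j) (M x * (u j).[x]).

Definition ubar u j : R := cell_mean u j / bracket j (fun=> 1).

Definition coef_a j : R :=
  bracket j (fun xi => xi - xi ^+ 2) / bracket j (fun xi => 1 - xi).
Definition coef_b j : R :=
  bracket j (fun xi => xi + xi ^+ 2) / bracket j (fun xi => 1 + xi).

Definition omega1 j (g : R) : R :=
  bracket j (fun xi => g - xi * (1 + g) + xi ^+ 2) / (2 * (1 + g)).
Definition omega3 j (g : R) : R :=
  bracket j (fun xi => - g + xi * (1 - g) + xi ^+ 2) / (2 * (1 - g)).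

Definition alpha1 (beta1 g : R) : R := (8 * beta1 - 1 + g) / (2 * (1 + g)).
Definition alpha3 (beta0 beta1 g : R) : R :=
  beta0 + (8 * beta1 - 3 + g) / (2 * (1 - g)).

Definition lambda0 (Lip g : R) : \bar R :=
  equot (\big[mine/+oo%E]_(j < N) mine (omega1 j g)%:E (omega3 j g)%:E)
        (2 * Lip).

(* The value 0 of an empty maximum is harmless, since A >= 0. *)
Definition maxA (A : R -> R -> R) u : R := \big[Num.max/0]_(j < N) avgA A u j.

(* The weight of the end point 1 is omega3 j g; it is often written
   omega1 j (- g), which denotes the same number only if <xi>_j = 0, because
   omega3 j g - omega1 j (- g) = <xi>_j.  For a general M it is omega3 j g that
   is needed here, as in lambda0. *)
Definition mu0 (A : R -> R -> R) (beta0 beta1 : R) u (g : R) : \bar R :=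
  equot
    (\big[mine/+oo%E]_(j < N)
       mine (mine
         (equot (omega1 j g)%:E (alpha3 beta0 beta1 (- g) + alpha1 beta1 g))
         (equot (omega3 j g)%:E (alpha3 beta0 beta1 g + alpha1 beta1 (- g))))
         (equot (bracket j (fun xi => 1 - xi ^+ 2))%:E (4 * (1 - 4 * beta1))))
    (2 * maxA A u).

End Weights.

Definition test_set j (g : R) : set R :=
  [set xmid j + h / 2 * xi | xi in [set -1; g; 1]].

End Mesh.

(* Main.v *)
Require Import Defs.
From mathcomp Require Import measurable_realfun ring lra.

(** Why the cell means stay in [c1, c2].

    Testing the scheme with the constant 1 leaves an update of the weighted
    cell mean by the differences of the convective and diffusive fluxes at the
    two ends of the cell ([scheme_cell_mean]).  On each cell the old solution is
    a quadratic polynomial, determined by its values at the reference points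
    -1, gamma, 1.  Everything is expressed by these nodal values.

    - The old cell mean is a three point quadrature of the nodal values
      ([cell_mean_nodes]).  Its weights are positive because gamma lies
      between the numbers coef_a and coef_b ([node_positivity]), and they add
      up to <1> ([omega_sum]).
    - The diffusive flux at an interface is the difference of two combinations,
      one of the nodal values in the cell to the right and one of those in the
      cell to the left ([diff_flux_nodes]).  The conditions on beta0, beta1 and
      gamma say that all the coefficients are nonnegative.

    The new mean is then a function of the nine nodal values in the cell and its
    two neighbours.  Half of the weight of each end point pays for the decrease
    of the monotone convective flux in the values of the cell itself, under the
    restriction on tau / h ([monotone_flux_bounds]).  The other half, with the
    weight of the interior point, pays for the diffusive flux, under the
    restriction on tau / h^2 ([diffusion_bounds]); this part is a combination of
    nodal values with nonnegative coefficients.  So the new mean is a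
    nondecreasing function of the nodal values, and it is equal to c <1> when
    all of them are equal to c, because the fluxes of a constant cancel.
    Division by <1> gives the claim.

    On the analytic side M is merely integrable, so the passage between a cell
    and the reference cell [-1, 1] is by transport of Lebesgue measure under
    affine maps ([Rintegral_affine]), and averages are compared through the
    three moments of M on the reference cell ([bracket_quad]). *)

Set Implicit Arguments.
Unset Strict Implicit.
Unset Printing Implicit Defensive.

Local Open Scope classical_set_scope.
Local Open Scope ring_scope.

(** * Affine change of variables for the Lebesgue integral *)

Lemma measurable_affine (R : realType) (m c : R) :
  measurable_fun [set: measurableTypeR R]
    ((fun t => m + c * t) : measurableTypeR R -> measurableTypeR R).
Proof.
apply: continuous_measurable_fun => x.
apply: cvgD; first exact: cvg_cst.
by apply: cvgM; [exact: cvg_cst|exact: cvg_id].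
Qed.

(** The canonical measure structure on a pushforward takes the measurability
    proof of the map as an argument, which unification cannot find; it is
    therefore supplied once and for all here. *)
Definition pushforward_affine (R : realType) (m c : R) :
    {measure set (measurableTypeR R) -> \bar R} :=
  measure_function_pushforward__canonical__measure_function_Measure
    lebesgue_measure (measurable_affine m c).

Lemma preimage_affine_itv (R : realType) (m c a b : R) (x y : bool) :
  0 < c -> (fun t => m + c * t) @^-1` [set` Interval (BSide x a) (BSide y b)]
  = [set` Interval (BSide x ((a - m) / c)) (BSide y ((b - m) / c))].
Proof.
move=> c_gt0; apply/seteqP.
by split=> t /=; rewrite !in_itv /= lteif_pdivrMr // lteif_pdivlMr //
    lteifBlDl lteifBrDl (mulrC t).
Qed.

(** Lebesgue measure is determined by its values on intervals, so it suffices
    that c times the image measure gives every interval its length. *)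
Lemma lebesgue_measure_affine (R : realType) (m c : R) (A : set R) :
  0 < c -> measurable A ->
  (@lebesgue_measure R ((fun t => (m + c * t)%R) @^-1` A)
   = c^-1%:E * @lebesgue_measure R A)%E.
Proof.
move=> c_gt0 mA; have c_ge0 := ltW c_gt0.
pose nu := mscale (NngNum c_ge0) (pushforward_affine m c).
have key : forall B : set (measurableTypeR R), measurable B ->
    lebesgue_measure B = nu B.
  apply: lebesgue_measure_unique => _ [[a b]] _ <-.
  rewrite /nu /= /mscale /= /pushforward preimage_affine_itv //.
  rewrite !lebesgue_measure_itv /= !lte_fin.
  rewrite ltr_pM2r ?invr_gt0 // ltrD2r; case: ifP => _; last by rewrite mule0.
  rewrite !EFinN -!EFinD -EFinM; congr (_%:E).
  by field; rewrite gt_eqF.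
by rewrite (key A mA) /nu /= /mscale /= muleA -EFinM mulVf ?gt_eqF // mul1e.
Qed.

Lemma ge0_integral_affine (R : realType) (m c : R) (D : set R)
    (f : R -> \bar R) :
  0 < c -> measurable D -> measurable_fun D f ->
  (forall x, D x -> 0 <= f x)%E ->
  (\int[lebesgue_measure]_(t in (fun t => (m + c * t)%R) @^-1` D)
     f (m + c * t)%R
   = c^-1%:E * \int[lebesgue_measure]_(x in D) f x)%E.
Proof.
move=> c_gt0 mD mf f0; have ci_ge0 : 0 <= c^-1 by rewrite invr_ge0 ltW.
transitivity (\int[mscale (NngNum ci_ge0) lebesgue_measure]_(x in D) f x)%E;
  last exact: ge0_integral_mscale.
rewrite -(@ge0_integral_pushforward _ _ _ _ _ _ (measurable_affine m c)
  lebesgue_measure D f) //; last by move=> x /set_mem /f0.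
apply: (@eq_measure_integral _ (measurableTypeR R) _ D
  (mscale (NngNum ci_ge0) lebesgue_measure) (pushforward_affine m c)) => B mB _.
exact: lebesgue_measure_affine.
Qed.

Lemma integrable_affine (R : realType) (m c : R) (D : set R) (f : R -> \bar R) :
  0 < c -> measurable D -> lebesgue_measure.-integrable D f ->
  lebesgue_measure.-integrable ((fun t => m + c * t) @^-1` D)
    (fun t => f (m + c * t)).
Proof.
move=> c_gt0 mD /integrableP[mf f_fin]; apply/integrableP; split.
  apply: (@measurable_comp _ _ _ _ _ _ D f) => //.
    by move=> _ [x Dx <-].
  exact: (measurable_funTS (measurable_affine m c)).
rewrite (@ge0_integral_affine _ m c D (fun x => `|f x|)%E) //.
  by rewrite lte_mul_pinfty // ?lee_fin ?invr_ge0 ?ltW.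
exact: measurableT_comp.
Qed.

Lemma Rintegral_affine (R : realType) (m c : R) (D : set R) (f : R -> R) :
  0 < c -> measurable D -> lebesgue_measure.-integrable D (EFin \o f) ->
  \int[lebesgue_measure]_(t in (fun t => m + c * t) @^-1` D) f (m + c * t)
  = c^-1 * \int[lebesgue_measure]_(x in D) f x.
Proof.
move=> c_gt0 mD intf.
have mf := measurable_int _ intf.
rewrite /Rintegral integralE [in RHS]integralE.
transitivity (fine
    (c^-1%:E * \int[lebesgue_measure]_(x in D) (EFin \o f)^\+ x
     - c^-1%:E * \int[lebesgue_measure]_(x in D) (EFin \o f)^\- x)%E).
  congr (fine (_ - _)%E).
    rewrite -(@ge0_integral_affine _ m c D (EFin \o f)^\+%E) //; last first.
      exact: measurable_funepos.
    by apply: eq_integral => x _; rewrite funeposE [in RHS]funeposE.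
  rewrite -(@ge0_integral_affine _ m c D (EFin \o f)^\-%E) //; last first.
      exact: measurable_funeneg.
    by apply: eq_integral => x _; rewrite funenegE [in RHS]funenegE.
have pfin : (\int[lebesgue_measure]_(x in D) (EFin \o f)^\+ x)%E \is a fin_num.
  by apply: integrable_fin_num => //; exact: integrable_funepos.
have nfin : (\int[lebesgue_measure]_(x in D) (EFin \o f)^\- x)%E \is a fin_num.
  by apply: integrable_fin_num => //; exact: integrable_funeneg.
rewrite -muleBr //; last by rewrite fin_num_adde_defr.
by rewrite fineM // fin_numB pfin nfin.
Qed.

Lemma integrableM_continuous (R : realType) (a b : R) (w q : R -> R) :
  lebesgue_measure.-integrable `[a, b] (EFin \o w) -> continuous q ->
  lebesgue_measure.-integrable `[a, b] (EFin \o (fun x => w x * q x)).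
Proof.
move=> w_int q_cont.
have mq : measurable_fun (`[a, b]%classic : set (measurableTypeR R)) q.
  by apply: measurable_funTS; exact: continuous_measurable_fun.
apply: eq_integrable (integrableMl _ w_int mq _) => //.
have /compact_bounded := continuous_compact (continuous_subspaceT q_cont)
  (@segment_compact R a b).
move=> [B [Breal HB]]; exists B; split => // M BM x abx /=.
by apply: HB => //=; exists x.
Qed.

(** An integral equal to zero would make w vanish almost everywhere, hence make
    the open interval, where w is positive, a null set. *)
Lemma Rintegral_gt0 (R : realType) (a b : R) (w : R -> R) : a < b ->
  lebesgue_measure.-integrable `[a, b] (EFin \o w) ->
  (forall x, a <= x <= b -> 0 <= w x) -> (forall x, a < x < b -> 0 < w x) ->
  0 < \int[lebesgue_measure]_(x in `[a, b]) w x.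
Proof.
move=> ab w_int w_ge0 w_gt0.
rewrite lt_def Rintegral_ge0 ?andbT; last first.
  by move=> x /=; rewrite in_itv; exact: w_ge0.
apply/eqP => int0.
have [mw _] := integrableP _ _ _ w_int.
have : (\int[lebesgue_measure]_(x in `[a, b]) `|(EFin \o w) x| = 0)%E.
  rewrite -[RHS]/(0%R%:E) -int0 fineK; last by apply: integrable_fin_num.
  apply: eq_integral => x /set_mem /=; rewrite in_itv /= => xab.
  by rewrite ger0_norm // w_ge0.
move=> /ae_eq_integral_abs [] // N [mN N0 sN].
have : (lebesgue_measure (`]a, b[%classic : set R) <= @lebesgue_measure R N)%E.
  apply: le_measure; rewrite ?inE //.
  move=> x /=; rewrite in_itv /= => /andP[ax xb]; apply: sN => /=.
  rewrite in_itv /= (ltW ax) (ltW xb) => /(_ isT) [] wx0.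
  by have := w_gt0 x; rewrite ax xb wx0 ltxx => /(_ isT).
rewrite N0 lebesgue_measure_itv /= lte_fin ab -EFinB lee_fin; lra.
Qed.

(** * The weighted averages on the reference cell *)

Section Cell.
Context {R : realType} {N : nat}.
Implicit Types (xa h : R) (j : 'I_N) (M : R -> R).

Lemma xleft_xmid xa h j : xleft xa h j = xmid xa h j + h / 2 * (-1).
Proof. rewrite /xmid /xleft /xright -addn1 natrD; lra. Qed.

Lemma xright_xmid xa h j : xright xa h j = xmid xa h j + h / 2 * 1.
Proof. rewrite /xmid /xleft /xright -addn1 natrD; lra. Qed.

Lemma cell_domain xa h j : 0 < h -> cell xa h j `<=` domain (N := N) xa h.
Proof.
move=> h_gt0 x; rewrite /cell /domain /= !in_itv /= /xleft /xright.
move=> /andP[jx xj].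
apply/andP; split; first by rewrite (le_trans _ jx) // lerDl mulr_ge0 // ltW.
by rewrite (le_trans xj) // lerD2l ler_pM2l // ler_nat.
Qed.

Lemma preimage_cell xa h j : 0 < h ->
  (fun t => xmid xa h j + h / 2 * t) @^-1` cell xa h j = `[-1, 1]%classic.
Proof.
move=> h_gt0; have c_gt0 : 0 < h / 2 by rewrite divr_gt0.
rewrite /cell preimage_affine_itv // xleft_xmid xright_xmid.
by rewrite !(addrC (xmid _ _ _)) !addrK !(mulrC (h / 2)) !mulfK ?gt_eqF.
Qed.

Lemma integrable_reference xa h j M : 0 < h ->
  lebesgue_measure.-integrable (domain (N := N) xa h) (EFin \o M) ->
  lebesgue_measure.-integrable `[-1, 1]
    (EFin \o (fun t => M (xmid xa h j + h / 2 * t))).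
Proof.
move=> h_gt0 M_int; rewrite -(preimage_cell xa j h_gt0).
apply: (@integrable_affine R (xmid xa h j) (h / 2) (cell xa h j) (EFin \o M)).
- by rewrite divr_gt0.
- exact: measurable_itv.
- by apply: integrableS M_int; [exact: measurable_itv..|exact: cell_domain].
Qed.

Lemma cell_meanE xa h M (u : 'I_N -> {poly R}) j : 0 < h ->
  lebesgue_measure.-integrable (domain (N := N) xa h) (EFin \o M) ->
  cell_mean xa h M u j =
  bracket xa h M j (fun t => (u j).[xmid xa h j + h / 2 * t]).
Proof.
move=> h_gt0 M_int; rewrite /cell_mean /bracket -(preimage_cell xa j h_gt0).
rewrite (@Rintegral_affine R (xmid xa h j) (h / 2) (cell xa h j)
   (fun x => M x * (u j).[x])); first last.
- apply: integrableM_continuous; last exact: continuous_horner.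
  by apply: integrableS M_int; [exact: measurable_itv..|exact: cell_domain].
- exact: measurable_itv.
- by rewrite divr_gt0.
by rewrite mulrA; congr (_ * _); field; rewrite gt_eqF.
Qed.

(** Every average in the scheme is that of a quadratic polynomial, so all of
    them reduce to the three moments <1>, <xi>, <xi^2>; the identities and
    inequalities between averages become algebra in these three numbers. *)
Lemma bracket_quad xa h M j (q : R -> R) (a b c : R) : 0 < h ->
  lebesgue_measure.-integrable (domain (N := N) xa h) (EFin \o M) ->
  (forall t, q t = a + b * t + c * t ^+ 2) ->
  bracket xa h M j q = a * bracket xa h M j (fun=> 1) +
    b * bracket xa h M j id + c * bracket xa h M j (fun t => t ^+ 2).
Proof.
move=> h_gt0 M_int qE.
have int_poly (p : {poly R}) (f : R -> R) :
    (forall t, f t = M (xmid xa h j + h / 2 * t) * p.[t]) ->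
    lebesgue_measure.-integrable `[-1, 1] (EFin \o f).
  move=> fE; rewrite (_ : f = fun t => M (xmid xa h j + h / 2 * t) * p.[t]).
    apply: integrableM_continuous; first exact: integrable_reference.
    exact: continuous_horner.
  by apply/funext => t; exact: fE.
rewrite /bracket !(mulrCA _ 2^-1) -!mulrDr; congr (_ * _).
rewrite -!RintegralZl //; first last.
- by apply: (int_poly 1) => t; rewrite !hornerE.
- by apply: (int_poly 'X) => t; rewrite !hornerE.
- by apply: (int_poly 'X^2) => t; rewrite !hornerE.
rewrite -!RintegralD //; first last.
- by apply: (int_poly (b%:P * 'X)) => t;
  rewrite ?(hornerD, hornerM, hornerC, hornerX, hornerXn); ring.
- by apply: (int_poly a%:P) => t;
  rewrite ?(hornerD, hornerM, hornerC, hornerX, hornerXn); ring.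
- by apply: (int_poly (c%:P * 'X^2)) => t;
  rewrite ?(hornerD, hornerM, hornerC, hornerX, hornerXn); ring.
- by apply: (int_poly (a%:P + b%:P * 'X)) => t;
  rewrite ?(hornerD, hornerM, hornerC, hornerX, hornerXn); ring.
by apply: eq_Rintegral => t _; rewrite qE; ring.
Qed.

Lemma bracket_gt0 xa h M j (q : R -> R) : 0 < h ->
  lebesgue_measure.-integrable (domain (N := N) xa h) (EFin \o M) ->
  (forall x, domain (N := N) xa h x -> 0 < M x) -> continuous q ->
  (forall t, -1 < t < 1 -> 0 < q t) -> (forall t, -1 <= t <= 1 -> 0 <= q t) ->
  0 < bracket xa h M j q.
Proof.
move=> h_gt0 M_int M_gt0 q_cont q_gt0 q_ge0.
have W_gt0 t : -1 <= t <= 1 -> 0 < M (xmid xa h j + h / 2 * t).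
  move=> t11; apply/M_gt0/(cell_domain (j := j) h_gt0).
  have : (`[-1, 1]%classic : set R) t by rewrite /= in_itv.
  by rewrite -(preimage_cell xa j h_gt0).
rewrite /bracket mulr_gt0 ?invr_gt0 //; apply: Rintegral_gt0; first lra.
- by apply: integrableM_continuous => //; exact: integrable_reference.
- by move=> t t11; rewrite mulr_ge0 ?q_ge0 // ltW // W_gt0.
- move=> t t11; rewrite mulr_gt0 ?q_gt0 // W_gt0 //; lra.
Qed.

End Cell.

(** * Nodal form of the cell means and of the diffusive flux *)

(** The derivatives are scaled by powers of c so that they are the derivatives
    in the reference variable t, in which the cell length has disappeared. *)
Lemma quadratic_horner (R : realType) (p : {poly R}) (m c : R) :
  (size p <= 3)%N -> exists e0 e1 e2 : R, forall t,
  [/\ p.[m + c * t] = e0 + e1 * t + e2 * t ^+ 2,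
      c * p^`().[m + c * t] = e1 + 2 * e2 * t &
      c ^+ 2 * p^`()^`().[m + c * t] = 2 * e2].
Proof.
move=> sp; exists (p`_0 + p`_1 * m + p`_2 * m ^+ 2).
exists (c * (p`_1 + 2 * p`_2 * m)), (c ^+ 2 * p`_2) => t.
have pE : p = (p`_0)%:P + (p`_1)%:P * 'X + (p`_2)%:P * 'X^2.
  apply/polyP => -[|[|[|i]]];
    rewrite !coefE /= ?(mulr0, mulr1, addr0, add0r) //.
  by rewrite nth_default // (leq_trans sp).
have p'E : p^`() = (p`_1)%:P + (2 * p`_2)%:P * 'X.
  rewrite {1}pE derivD derivD derivC !derivM !derivC !derivX polyCM; ring.
have p''E : p^`()^`() = (2 * p`_2)%:P.
  by rewrite p'E derivD derivM !derivC derivX; ring.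
rewrite p''E p'E [in p.[_]]pE !(hornerD, hornerM, hornerC, hornerX, hornerXn).
by split; ring.
Qed.

(** The weight of the interior node in the three point quadrature rule below. *)
Definition omega2 (R : realType) (N : nat) (xa h : R) (M : R -> R) (j : 'I_N)
  (g : R) : R := bracket xa h M j (fun t => 1 - t ^+ 2) / (1 - g ^+ 2).

(** The coefficient of the interior nodal values in the diffusive flux. *)
Definition alpha2 (R : realType) (beta1 g : R) : R :=
  2 * (1 - 4 * beta1) / (1 - g ^+ 2).

Section Nodes.
Context {R : realType} {N : nat}.
Implicit Types (xa h g : R) (j : 'I_N) (M : R -> R) (u : 'I_N -> {poly R}).

(** A quadratic polynomial is determined by its values at -1, g, 1, so the flux
    is a combination of the three nodal values on either side.  The values
    to the right enter with a plus sign and those to the left with a minus sign;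
    this makes the diffusive part monotone as soon as the coefficients alpha1,
    alpha2 and alpha3 are nonnegative. *)
Lemma diff_flux_nodes xa h beta0 beta1 g u j :
  0 < h -> -1 < g < 1 -> in_Vh 2 u ->
  h * diff_flux xa h beta0 beta1 u j =
    alpha3 beta0 beta1 (- g) * (u (ordS j)).[xleft xa h (ordS j)]
    + alpha2 beta1 g * (u (ordS j)).[xmid xa h (ordS j) + h / 2 * g]
    + alpha1 beta1 (- g) * (u (ordS j)).[xright xa h (ordS j)]
    - (alpha1 beta1 g * (u j).[xleft xa h j]
       + alpha2 beta1 g * (u j).[xmid xa h j + h / 2 * g]
       + alpha3 beta0 beta1 g * (u j).[xright xa h j]).
Proof.
move=> h_gt0 /andP[g_gtN1 g_lt1] u_Vh.
have c_gt0 : 0 < h / 2 by rewrite divr_gt0.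
have c2_neq0 : (h / 2) ^+ 2 != 0 by rewrite expf_neq0 ?gt_eqF.
rewrite /diff_flux /avg /jump /lim_left /lim_right /ddx.
rewrite !xleft_xmid !xright_xmid.
set i := ordS j.
have [d0 [d1 [d2 dE]]] := quadratic_horner (xmid xa h j) (h / 2) (u_Vh j).
have [e0 [e1 [e2 eE]]] := quadratic_horner (xmid xa h i) (h / 2) (u_Vh i).
have [dN _ _] := dE (-1).
have [d_1 /(canRL (mulKf (lt0r_neq0 c_gt0))) d1'
  /(canRL (mulKf c2_neq0)) d1''] := dE 1.
have [dg _ _] := dE g.
have [eN /(canRL (mulKf (lt0r_neq0 c_gt0))) eN'
  /(canRL (mulKf c2_neq0)) eN''] := eE (-1).
have [e_1 _ _] := eE 1.
have [eg _ _] := eE g.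
rewrite dN dg d_1 d1' d1'' eN eg e_1 eN' eN'' /alpha1 /alpha2 /alpha3.
field; rewrite !gt_eqF //; lra || nra.
Qed.

Lemma omega1E xa h M j g : 0 < h ->
  lebesgue_measure.-integrable (domain (N := N) xa h) (EFin \o M) ->
  omega1 xa h M j g = (g * bracket xa h M j (fun=> 1)
    - (1 + g) * bracket xa h M j id + bracket xa h M j (fun t => t ^+ 2))
    / (2 * (1 + g)).
Proof.
move=> h_gt0 M_int; congr (_ / _).
rewrite (@bracket_quad _ _ _ _ _ _ _ g (- (1 + g)) 1) //; first ring.
by move=> t; ring.
Qed.

Lemma omega2E xa h M j g : 0 < h ->
  lebesgue_measure.-integrable (domain (N := N) xa h) (EFin \o M) ->
  omega2 xa h M j g = (bracket xa h M j (fun=> 1)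
    - bracket xa h M j (fun t => t ^+ 2)) / (1 - g ^+ 2).
Proof.
move=> h_gt0 M_int; congr (_ / _).
rewrite (@bracket_quad _ _ _ _ _ _ _ 1 0 (-1)) //; first ring.
by move=> t; ring.
Qed.

Lemma omega3E xa h M j g : 0 < h ->
  lebesgue_measure.-integrable (domain (N := N) xa h) (EFin \o M) ->
  omega3 xa h M j g = (- g * bracket xa h M j (fun=> 1)
    + (1 - g) * bracket xa h M j id + bracket xa h M j (fun t => t ^+ 2))
    / (2 * (1 - g)).
Proof.
move=> h_gt0 M_int; congr (_ / _).
rewrite (@bracket_quad _ _ _ _ _ _ _ (- g) (1 - g) 1) //; first ring.
by move=> t; ring.
Qed.

(** The weights are the averages of the Lagrange basis polynomials for the nodes
    -1, g, 1; the rule is therefore exact on quadratic polynomials. *)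
Lemma cell_mean_nodes xa h M u j g : 0 < h -> -1 < g < 1 ->
  lebesgue_measure.-integrable (domain (N := N) xa h) (EFin \o M) ->
  in_Vh 2 u ->
  cell_mean xa h M u j =
    omega1 xa h M j g * (u j).[xleft xa h j]
    + omega2 xa h M j g * (u j).[xmid xa h j + h / 2 * g]
    + omega3 xa h M j g * (u j).[xright xa h j].
Proof.
move=> h_gt0 /andP[g_gtN1 g_lt1] M_int u_Vh.
rewrite cell_meanE // omega1E // omega2E // omega3E // xleft_xmid xright_xmid.
have [e0 [e1 [e2 eE]]] := quadratic_horner (xmid xa h j) (h / 2) (u_Vh j).
have [eN _ _] := eE (-1); have [eg _ _] := eE g; have [e_1 _ _] := eE 1.
rewrite eN eg e_1 (@bracket_quad _ _ _ _ _ _ _ e0 e1 e2) //; last first.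
  by move=> t; have [] := eE t.
field; rewrite !gt_eqF //; lra || nra.
Qed.

Lemma omega_sum xa h M j g : 0 < h -> -1 < g < 1 ->
  lebesgue_measure.-integrable (domain (N := N) xa h) (EFin \o M) ->
  omega1 xa h M j g + omega2 xa h M j g + omega3 xa h M j g
  = bracket xa h M j (fun=> 1).
Proof.
move=> h_gt0 /andP[g_gtN1 g_lt1] M_int.
rewrite omega1E // omega2E // omega3E //.
field; rewrite !gt_eqF //; lra || nra.
Qed.

End Nodes.

(** * Positivity of the quadrature weights *)

Section Weights.
Context {R : realType} {N : nat}.
Implicit Types (xa h g : R) (j : 'I_N) (M : R -> R) (u : 'I_N -> {poly R}).

Lemma moments_gt0 xa h M j : 0 < h ->
  lebesgue_measure.-integrable (domain (N := N) xa h) (EFin \o M) ->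
  (forall x, domain (N := N) xa h x -> 0 < M x) ->
  [/\ 0 < bracket xa h M j (fun=> 1) - bracket xa h M j id,
      0 < bracket xa h M j (fun=> 1) + bracket xa h M j id &
      0 < bracket xa h M j (fun=> 1) - bracket xa h M j (fun t => t ^+ 2)].
Proof.
move=> h_gt0 M_int M_gt0.
have pos (a b c : R) : (forall t, -1 < t < 1 -> 0 < a + b * t + c * t ^+ 2) ->
    (forall t, -1 <= t <= 1 -> 0 <= a + b * t + c * t ^+ 2) ->
    0 < a * bracket xa h M j (fun=> 1) + b * bracket xa h M j id
      + c * bracket xa h M j (fun t => t ^+ 2).
  move=> q_gt0 q_ge0.
  rewrite -(@bracket_quad _ _ _ _ _ _ (fun t => a + b * t + c * t ^+ 2)) //.
  apply: bracket_gt0 => //.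
  rewrite (_ : (fun t => _) = horner (a%:P + b%:P * 'X + c%:P * 'X^2)).
    exact: continuous_horner.
  by apply/funext => t; rewrite !(hornerD, hornerM, hornerC, hornerX, hornerXn).
split.
- have := pos 1 (-1) 0; rewrite mul1r mulN1r mul0r addr0.
  by apply=> t t11; lra.
- have := pos 1 1 0; rewrite !mul1r mul0r addr0.
  by apply=> t t11; lra.
- have := pos 1 0 (-1); rewrite mul1r mul0r mulN1r addr0.
  by apply=> t t11; nra.
Qed.

(** The numerators of omega1 and omega3 are g <1 - xi> - <xi - xi^2> and
    <xi + xi^2> - g <1 + xi>, which are positive exactly when
    coef_a < g < coef_b.  Since <1 - xi^2> > 0, moreover -1 < coef_a and
    coef_b < 1, so that g is an interior point of the reference cell. *)
Lemma node_positivity xa h M j g : 0 < h ->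
  lebesgue_measure.-integrable (domain (N := N) xa h) (EFin \o M) ->
  (forall x, domain (N := N) xa h x -> 0 < M x) ->
  coef_a xa h M j < g < coef_b xa h M j ->
  [/\ -1 < g < 1, 0 < omega1 xa h M j g & 0 < omega3 xa h M j g].
Proof.
move=> h_gt0 M_int M_gt0.
have [m01 m0'1 m02] := moments_gt0 j h_gt0 M_int M_gt0.
rewrite omega1E // omega3E // /coef_a /coef_b.
rewrite (@bracket_quad _ _ _ _ _ _ (fun t => t - t ^+ 2) 0 1 (-1)) //;
  last by move=> t; ring.
rewrite (@bracket_quad _ _ _ _ _ _ (fun t => 1 - t) 1 (-1) 0) //;
  last by move=> t; ring.
rewrite (@bracket_quad _ _ _ _ _ _ (fun t => t + t ^+ 2) 0 1 1) //;
  last by move=> t; ring.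
rewrite (@bracket_quad _ _ _ _ _ _ (fun t => 1 + t) 1 1 0) //;
  last by move=> t; ring.
move: m01 m0'1 m02; set m0 := bracket _ _ _ _ _; set m1 := bracket _ _ _ _ id.
set m2 := bracket _ _ _ _ _ => m01 m0'1 m02.
rewrite ltr_pdivrMr; last lra.
rewrite ltr_pdivlMr; last lra.
move=> /andP[ga gb].
have gN1 : -1 < g by nra.
have g1 : g < 1 by nra.
by split; [rewrite gN1 g1|rewrite divr_gt0//; lra..].
Qed.

Lemma bracket1Bsqr_ge0 xa h M j : 0 < h ->
  lebesgue_measure.-integrable (domain (N := N) xa h) (EFin \o M) ->
  (forall x, domain (N := N) xa h x -> 0 < M x) ->
  0 <= bracket xa h M j (fun t => 1 - t ^+ 2).
Proof.
move=> h_gt0 M_int M_gt0; have [_ _] := moments_gt0 j h_gt0 M_int M_gt0.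
rewrite (@bracket_quad _ _ _ _ _ _ (fun t => 1 - t ^+ 2) 1 0 (-1)) //;
  last by move=> t; ring.
lra.
Qed.

End Weights.

(** * The time step restrictions *)

Lemma equot_ge0 (R : realType) (a : \bar R) (b : R) : (0 <= a)%E -> 0 <= b ->
  (0 <= equot a b)%E.
Proof.
by move=> a_ge0 b_ge0; rewrite /equot; case: ifP => // _;
  rewrite mule_ge0 // lee_fin invr_ge0.
Qed.

(** Multiplied out, a bound by a quotient holds uniformly: also for b = 0, where
    the quotient is +oo and b * x is 0. *)
Lemma equot_ge (R : realType) (a : \bar R) (b x : R) : (0 <= a)%E -> 0 <= b ->
  (x%:E <= equot a b)%E -> ((b * x)%:E <= a)%E.
Proof.
move=> a_ge0 b_ge0; rewrite /equot; have [->|b_neq0] := eqVneq b 0.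
  by rewrite mul0r.
have b_gt0 : 0 < b by rewrite lt_def b_neq0.
by rewrite lee_pdivlMr // -EFinM mulrC.
Qed.

Lemma lambda0_le (R : realType) (N : nat) (xa h Lip g lam : R) (M : R -> R) :
  0 <= Lip ->
  (forall j : 'I_N, 0 < omega1 xa h M j g) ->
  (forall j : 'I_N, 0 < omega3 xa h M j g) ->
  (lam%:E <= lambda0 (N := N) xa h M Lip g)%E ->
  forall j : 'I_N, 2 * Lip * lam <= omega1 xa h M j g /\
                   2 * Lip * lam <= omega3 xa h M j g.
Proof.
move=> Lip_ge0 w1_gt0 w3_gt0 lam_le j.
have /(_ _ _)/le_trans lam' := equot_ge _ _ lam_le.
have : ((2 * Lip * lam)%:E
    <= Order.min (omega1 xa h M j g)%:E (omega3 xa h M j g)%:E)%E.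
  apply: lam'; [|by rewrite mulr_ge0|exact: bigmin_le].
  by apply: le_bigmin => // i _; rewrite le_min !lee_fin !ltW.
by rewrite le_min !lee_fin => /andP.
Qed.

Lemma mu0_le (R : realType) (N : nat) (xa h beta0 beta1 g mu : R) (M : R -> R)
  (A : R -> R -> R) (u : 'I_N -> {poly R}) :
  (forall j : 'I_N, 0 <= omega1 xa h M j g) ->
  (forall j : 'I_N, 0 <= omega3 xa h M j g) ->
  (forall j : 'I_N, 0 <= bracket xa h M j (fun t => 1 - t ^+ 2)) ->
  0 <= alpha3 beta0 beta1 (- g) + alpha1 beta1 g ->
  0 <= alpha3 beta0 beta1 g + alpha1 beta1 (- g) ->
  beta1 <= 1 / 4 ->
  (mu%:E <= mu0 xa h M A beta0 beta1 u g)%E ->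
  forall j : 'I_N,
  [/\ (alpha3 beta0 beta1 (- g) + alpha1 beta1 g) * (2 * maxA xa h A u * mu)
        <= omega1 xa h M j g,
      (alpha3 beta0 beta1 g + alpha1 beta1 (- g)) * (2 * maxA xa h A u * mu)
        <= omega3 xa h M j g &
      4 * (1 - 4 * beta1) * (2 * maxA xa h A u * mu)
        <= bracket xa h M j (fun t => 1 - t ^+ 2)].
Proof.
move=> w1 w3 w2 a31 a31' b1 mu_le j.
have b1' : 0 <= 4 * (1 - 4 * beta1) by lra.
have maxA_ge0 : 0 <= maxA xa h A u by exact: bigmax_ge_id.
set m := 2 * _ * mu.
pose F (i : 'I_N) : \bar R := mine (mine
   (equot (omega1 xa h M i g)%:E (alpha3 beta0 beta1 (- g) + alpha1 beta1 g))
   (equot (omega3 xa h M i g)%:E (alpha3 beta0 beta1 g + alpha1 beta1 (- g))))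
   (equot (bracket xa h M i (fun xi => 1 - xi ^+ 2))%:E (4 * (1 - 4 * beta1))).
have : (m%:E <= F j)%E.
  apply: le_trans (bigmin_le _ j F).
  apply: equot_ge mu_le; last by rewrite mulr_ge0.
  by apply: le_bigmin => // i _; rewrite !le_min !equot_ge0 ?lee_fin.
rewrite /F !le_min => /andP[/andP[m1 m3] m2].
by split; rewrite -lee_fin; apply: equot_ge; rewrite ?lee_fin.
Qed.

(** * Monotonicity of the two parts of the scheme *)

Lemma convex_bounds (R : realType) (c1 c2 : R) (s : seq (R * R)) :
  all (fun kx => (0 <= kx.1) && (c1 <= kx.2 <= c2)) s ->
  c1 * (\sum_(kx <- s) kx.1) <= \sum_(kx <- s) kx.1 * kx.2
    <= c2 * (\sum_(kx <- s) kx.1).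
Proof.
move=> /allP s_ok; rewrite !mulr_sumr !big_seq.
apply/andP; split;
  apply: ler_sum => -[k x] /s_ok /= /andP[k_ge0 /andP[c1x xc2]].
  by rewrite mulrC ler_wpM2l.
by rewrite (mulrC c2) ler_wpM2l.
Qed.

(** The convective part is nondecreasing in ym and xp by monotonicity of F.  In
    x and y, where F acts with the opposite sign, the terms w * x and w' * y
    compensate its decrease, which the Lipschitz bound limits to lam * Lip.  For
    arguments all equal to c the flux difference vanishes and c * (w + w') is
    left, so replacing all the arguments by c1 or by c2 gives the bounds. *)
Lemma monotone_flux_bounds (R : realType) (f : R -> R) (Lip : R)
  (F : R -> R -> R) (c1 c2 lam w w' x y xp ym : R) :
  monotone_flux f Lip F -> 0 <= lam -> Lip * lam <= w -> Lip * lam <= w' ->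
  c1 <= x <= c2 -> c1 <= y <= c2 -> c1 <= xp <= c2 -> c1 <= ym <= c2 ->
  c1 * (w + w') <= w * x + w' * y - lam * (F y xp - F ym x) <= c2 * (w + w').
Proof.
move=> [lipF incF decF _] lam_ge0 lw lw'.
move=> /andP[c1x xc2] /andP[c1y yc2] /andP[c1xp xpc2] /andP[c1ym ymc2].
have lipF1 a b v : a <= b -> F b v - F a v <= Lip * (b - a).
  move=> ab; apply: (le_trans (ler_norm _)); apply: (le_trans (lipF _ _ _ _)).
  by rewrite subrr normr0 addr0 ger0_norm ?subr_ge0.
have lipF2 a v v' : v <= v' -> F a v - F a v' <= Lip * (v' - v).
  move=> vv'; apply: (le_trans (ler_norm _)); apply: (le_trans (lipF _ _ _ _)).
  by rewrite subrr normr0 add0r distrC ger0_norm ?subr_ge0.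
have up : lam * (F ym x - F y xp) <= lam * (Lip * (c2 - x) + Lip * (c2 - y)).
  apply: ler_wpM2l => //.
  have := incF ym c2 x ymc2; have := decF y xp c2 xpc2.
  have := lipF1 y c2 c2 yc2; have := lipF2 c2 x c2 xc2; lra.
have lo : lam * (F y xp - F ym x) <= lam * (Lip * (x - c1) + Lip * (y - c1)).
  apply: ler_wpM2l => //.
  have := incF c1 ym x c1ym; have := decF y c1 xp c1xp.
  have := lipF1 c1 y c1 c1y; have := lipF2 c1 c1 x c1x; lra.
apply/andP; split; nra.
Qed.

(** Collecting terms, this is a combination of the nine values with nonnegative
    coefficients: those of p, g and s are nonnegative by the three bounds on
    Amax * mu, the others by sign.  The identity a3' - a1 = a3 - a1' says that
    the flux of a constant vanishes, so the coefficients add up to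
    w1 + w2 + w3. *)
Lemma diffusion_bounds (R : realType)
  (c1 c2 mu a1 a1' a2 a3 a3' B C Amax w1 w2 w3 p g s pp gp sp pm gm sm : R) :
  0 <= mu -> 0 <= B <= Amax -> 0 <= C <= Amax ->
  0 <= a1 -> 0 <= a1' -> 0 <= a2 -> 0 <= a3 -> 0 <= a3' ->
  a3' - a1 = a3 - a1' ->
  (a3' + a1) * (Amax * mu) <= w1 -> 2 * a2 * (Amax * mu) <= w2 ->
  (a3 + a1') * (Amax * mu) <= w3 ->
  all (fun x => c1 <= x <= c2) [:: p; g; s; pp; gp; sp; pm; gm; sm] ->
  c1 * (w1 + w2 + w3) <=
    w1 * p + w2 * g + w3 * s
    + mu * (B * (a3' * pp + a2 * gp + a1' * sp - (a1 * p + a2 * g + a3 * s))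
          - C * (a3' * p + a2 * g + a1' * s - (a1 * pm + a2 * gm + a3 * sm)))
  <= c2 * (w1 + w2 + w3).
Proof.
move=> mu_ge0 /andP[B_ge0 B_le] /andP[C_ge0 C_le].
move=> a1_ge0 a1'_ge0 a2_ge0 a3_ge0 a3'_ge0 a_sum w1_ge w2_ge w3_ge.
move=> /= /and5P[hp hg hs hpp /and5P[hgp hsp hpm hgm /andP[hsm _]]].
have mu_le (x y D : R) : 0 <= x -> 0 <= y -> (x + y) * (Amax * mu) <= D ->
    mu * (B * x + C * y) <= D.
  move=> x_ge0 y_ge0; apply: le_trans.
  have : B * x + C * y <= Amax * (x + y) by nra.
  by move=> /(ler_wpM2l mu_ge0) /le_trans; apply; lra.
pose s9 := [:: (w1 - mu * (B * a1 + C * a3'), p);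
               (w2 - mu * (B * a2 + C * a2), g);
               (w3 - mu * (B * a3 + C * a1'), s);
               (mu * B * a3', pp); (mu * B * a2, gp); (mu * B * a1', sp);
               (mu * C * a1, pm); (mu * C * a2, gm); (mu * C * a3, sm)].
have s9_ok : all (fun kx => (0 <= kx.1) && (c1 <= kx.2 <= c2)) s9.
  rewrite /= hp hg hs hpp hgp hsp hpm hgm hsm !mulr_ge0 // !andbT !subr_ge0.
  by rewrite !mu_le //; lra.
have := convex_bounds s9_ok; rewrite /s9 !big_cons !big_nil /=.
have a3'E : a3' = a3 - a1' + a1 by lra.
congr (_ && _); congr (_ <= _); rewrite ?a3'E; ring.
Qed.

(** * Evolution of the cell means *)

(** With the constant test function 1 all the terms containing a derivative of
    the test function disappear, and only the interface fluxes remain. *)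
Lemma scheme_cell_mean (R : realType) (N k : nat) (xa h tau : R)
  (M f : R -> R) (A fhat : R -> R -> R) (beta0 beta1 : R)
  (u0 u1 : 'I_N -> {poly R}) :
  0 < h -> 0 < tau ->
  lebesgue_measure.-integrable (domain (N := N) xa h) (EFin \o M) ->
  scheme xa h k M f A fhat beta0 beta1 tau u0 u1 ->
  forall j, cell_mean xa h M u1 j = cell_mean xa h M u0 j
    - tau / h * (num_flux xa h fhat u0 j - num_flux xa h fhat u0 (ord_pred j))
    + tau / h * (avgA xa h A u0 j * diff_flux xa h beta0 beta1 u0 j
        - avgA xa h A u0 (ord_pred j)
            * diff_flux xa h beta0 beta1 u0 (ord_pred j)).
Proof.
move=> h_gt0 tau_gt0 M_int u_scheme j.
have one_Vh : in_Vh k (fun _ : 'I_N => 1 : {poly R}).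
  by move=> i; rewrite size_poly1.
have := u_scheme _ one_Vh j.
have ddx1 : ddx (fun _ : 'I_N => 1 : {poly R}) j = 0 by rewrite /ddx derivC.
have int0 (q : R -> R) : (forall x, q x = 0) ->
    \int[lebesgue_measure]_(x in cell xa h j) q x = 0.
  move=> q0; under eq_Rintegral do rewrite q0.
  by rewrite Rintegral_cst ?mul0r //; exact: measurable_itv.
have int_u (u : 'I_N -> {poly R}) : lebesgue_measure.-integrable (cell xa h j)
    (EFin \o (fun x => M x * (u j).[x])).
  apply: integrableM_continuous; last exact: continuous_horner.
  by apply: integrableS M_int; [exact: measurable_itv..|exact: cell_domain].
rewrite (int0 (fun x => f _ * _)); last by move=> x; rewrite ddx1 horner0 mulr0.
rewrite (int0 (fun x => A _ _ * _ * _)); last first.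
  by move=> x; rewrite ddx1 horner0 mulr0.
rewrite /diff_bnd ddx1 !hornerC !mulr0 !mulr1 !addr0 sub0r subr0.
have -> : \int[lebesgue_measure]_(x in cell xa h j)
    (M x * (((u1 j).[x] - (u0 j).[x]) / tau) * (1 : {poly R}).[x])
  = tau^-1 * (h * cell_mean xa h M u1 j - h * cell_mean xa h M u0 j).
  rewrite /cell_mean !mulrA divff ?gt_eqF // !mul1r.
  rewrite -RintegralB ?int_u //; last exact: measurable_itv.
  rewrite -RintegralZl; last 2 first.
  - exact: measurable_itv.
  - rewrite (_ : _ \o _ = EFin \o (fun x => M x * (u1 j - u0 j).[x])).
      exact: (int_u (fun i => u1 i - u0 i)).
    by apply/funext => x /=; rewrite hornerD hornerN mulrBr.
  by apply: eq_Rintegral => x _; rewrite hornerC; ring.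
move=> E; apply: (mulfI (lt0r_neq0 h_gt0)).
have := congr1 (fun z => tau * z) E.
rewrite mulrA divff ?gt_eqF // mul1r => /eqP; rewrite subr_eq => /eqP ->.
field; exact: lt0r_neq0.
Qed.

Theorem theorem2p4 (R : realType) (N : nat) (xa h tau : R)
  (M f : R -> R) (A fhat : R -> R -> R)
  (Lip beta0 beta1 gamma c1 c2 : R)
  (u0 u1 : 'I_N -> {poly R})
  (N_gt0 : (0 < N)%N) (h_gt0 : 0 < h) (tau_gt0 : 0 < tau)
  (M_gt0 : forall x, domain (N := N) xa h x -> 0 < M x)
  (M_int : lebesgue_measure.-integrable (domain (N := N) xa h) (EFin \o M))
  (f_smooth : smooth f)
  (A_ge0 : forall x w, domain (N := N) xa h x -> 0 <= A x w)
  (fhat_flux : monotone_flux f Lip fhat)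
  (c1_le_c2 : c1 <= c2)
  (u0_Vh : in_Vh 2 u0) (u1_Vh : in_Vh 2 u1)
  (u_scheme : scheme xa h 2 M f A fhat beta0 beta1 tau u0 u1)
  (beta0_ge1 : 1 <= beta0) (beta1_bound : 1 / 8 <= beta1 <= 1 / 4)
  (gamma_ab : forall j : 'I_N, coef_a xa h M j < gamma < coef_b xa h M j)
  (gamma_beta1 : `|gamma| <= 8 * beta1 - 1)
  (cfl_lambda : ((tau / h)%:E <= lambda0 (N := N) xa h M Lip gamma)%E)
  (cfl_mu : ((tau / h ^+ 2)%:E <= mu0 xa h M A beta0 beta1 u0 gamma)%E) :
  (forall (j : 'I_N) (x : R), test_set xa h j gamma x ->
     c1 <= (u0 j).[x] <= c2) ->
  forall j : 'I_N, c1 <= ubar xa h M u1 j <= c2.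
Proof.
move=> u0_bounds j.
have nodes i := node_positivity h_gt0 M_int M_gt0 (gamma_ab i).
have [g11 _ _] := nodes j; have /andP[gN1 g1] := g11.
have [gb1 gb2] : 0 <= 8 * beta1 - 1 + gamma /\ 0 <= 8 * beta1 - 1 - gamma.
  by move: gamma_beta1; rewrite ler_norml => /andP[]; split; lra.
have /andP[b1_lo b1_hi] := beta1_bound.
have a1_ge0 : 0 <= alpha1 beta1 gamma by rewrite divr_ge0 //; lra.
have a1'_ge0 : 0 <= alpha1 beta1 (- gamma) by rewrite divr_ge0 //; lra.
have a2_ge0 : 0 <= alpha2 beta1 gamma by rewrite divr_ge0 //; nra.
(* The next two identities show at once that alpha3 is nonnegative for
   beta0 >= 1, and that the diffusive flux of a constant is zero. *)
have a31' : alpha3 beta0 beta1 (- gamma) = alpha1 beta1 gamma + (beta0 - 1).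
  by rewrite /alpha3 /alpha1; field; rewrite gt_eqF //; lra.
have a31 : alpha3 beta0 beta1 gamma = alpha1 beta1 (- gamma) + (beta0 - 1).
  by rewrite /alpha3 /alpha1; field; rewrite gt_eqF //; lra.
have a3_ge0 : 0 <= alpha3 beta0 beta1 gamma by lra.
have a3'_ge0 : 0 <= alpha3 beta0 beta1 (- gamma) by lra.
have Lip_ge0 : 0 <= Lip.
  have := flux_lipschitz fhat_flux 1 0 0 0.
  by rewrite !subr0 normr1 normr0 addr0 mulr1; exact: le_trans.
have [lam1 lam3] := lambda0_le Lip_ge0
  (fun i => let: And3 _ w _ := nodes i in w)
  (fun i => let: And3 _ _ w := nodes i in w) cfl_lambda j.
have [mu1 mu3 mu2] := mu0_le
  (fun i => let: And3 _ w _ := nodes i in ltW w)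
  (fun i => let: And3 _ _ w := nodes i in ltW w)
  (fun i => bracket1Bsqr_ge0 i h_gt0 M_int M_gt0)
  (addr_ge0 a3'_ge0 a1_ge0) (addr_ge0 a3_ge0 a1'_ge0) b1_hi cfl_mu j.
have avgA_bounds i : 0 <= avgA xa h A u0 i <= maxA xa h A u0.
  rewrite le_bigmax andbT divr_ge0 // addr_ge0 // A_ge0 //.
    apply: (cell_domain (j := i)) => //.
    rewrite /cell /= in_itv /= lexx andbT /xleft /xright lerD2l ler_pM2l //.
    by rewrite ler_nat.
  apply: (cell_domain (j := ordS i)) => //.
  rewrite /cell /= in_itv /= lexx /= /xleft /xright lerD2l ler_pM2l //.
  by rewrite ler_nat.
have m0_gt0 : 0 < bracket xa h M j (fun=> 1).
  by have [] := moments_gt0 j h_gt0 M_int M_gt0; lra.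
rewrite /ubar ler_pdivlMr // ler_pdivrMr //.
set jm := ord_pred j; set jp := ordS j.
have jmS : ordS jm = j by rewrite ord_predK.
pose P i := (u0 i).[xleft xa h i].
pose G i := (u0 i).[xmid xa h i + h / 2 * gamma].
pose S i := (u0 i).[xright xa h i].
have P_bounds i : c1 <= P i <= c2.
  by apply: u0_bounds; exists (-1); rewrite ?xleft_xmid //=; left; left.
have G_bounds i : c1 <= G i <= c2.
  by apply: u0_bounds; exists gamma => //=; left; right.
have S_bounds i : c1 <= S i <= c2.
  by apply: u0_bounds; exists 1; rewrite ?xright_xmid //=; right.
have all_bounds : all (fun x => c1 <= x <= c2)
    [:: P j; G j; S j; P jp; G jp; S jp; P jm; G jm; S jm].
  by rewrite /= !P_bounds !G_bounds !S_bounds.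
have lam_ge0 : 0 <= tau / h by rewrite divr_ge0 // ltW.
have mu_ge0 : 0 <= tau / h ^+ 2 by rewrite divr_ge0 // ?exprn_ge0 // ltW.
have lam1' : Lip * (tau / h) <= omega1 xa h M j gamma / 2 by lra.
have lam3' : Lip * (tau / h) <= omega3 xa h M j gamma / 2 by lra.
have a_sum : alpha3 beta0 beta1 (- gamma) - alpha1 beta1 gamma
           = alpha3 beta0 beta1 gamma - alpha1 beta1 (- gamma).
  by rewrite a31 a31'; ring.
have mu1' : (alpha3 beta0 beta1 (- gamma) + alpha1 beta1 gamma)
   * (maxA xa h A u0 * (tau / h ^+ 2)) <= omega1 xa h M j gamma / 2 by lra.
have mu3' : (alpha3 beta0 beta1 gamma + alpha1 beta1 (- gamma))
   * (maxA xa h A u0 * (tau / h ^+ 2)) <= omega3 xa h M j gamma / 2 by lra.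
have mu2' : 2 * alpha2 beta1 gamma * (maxA xa h A u0 * (tau / h ^+ 2))
    <= omega2 xa h M j gamma.
  have d_gt0 : 0 < 1 - gamma ^+ 2 by nra.
  rewrite /omega2 ler_pdivlMr // /alpha2.
  rewrite [leLHS](_ : _ =
    4 * (1 - 4 * beta1) * (maxA xa h A u0 * (tau / h ^+ 2))).
    have := bracket1Bsqr_ge0 j h_gt0 M_int M_gt0; lra.
  by field; rewrite !gt_eqF.
have nodesE i : h * diff_flux xa h beta0 beta1 u0 i =
    alpha3 beta0 beta1 (- gamma) * P (ordS i) + alpha2 beta1 gamma * G (ordS i)
    + alpha1 beta1 (- gamma) * S (ordS i)
    - (alpha1 beta1 gamma * P i + alpha2 beta1 gamma * G i
       + alpha3 beta0 beta1 gamma * S i) by exact: diff_flux_nodes.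
have /andP[flux_lo flux_hi] := monotone_flux_bounds fhat_flux lam_ge0
  lam1' lam3'
  (P_bounds j) (S_bounds j) (P_bounds jp) (S_bounds jm).
have /andP[diff_lo diff_hi] := diffusion_bounds mu_ge0 (avgA_bounds j)
  (avgA_bounds jm) a1_ge0 a1'_ge0 a2_ge0 a3_ge0 a3'_ge0 a_sum mu1' mu2' mu3'
  (all_bounds).
(* The weights of the end points are halved between convection and diffusion,
   which both consume them; the interior node serves diffusion alone. *)
have -> : cell_mean xa h M u1 j =
   (omega1 xa h M j gamma / 2 * P j + omega3 xa h M j gamma / 2 * S j
   - tau / h * (fhat (S j) (P jp) - fhat (S jm) (P j)))
   + (omega1 xa h M j gamma / 2 * P j + omega2 xa h M j gamma * G j
      + omega3 xa h M j gamma / 2 * S j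
      + tau / h ^+ 2 * (avgA xa h A u0 j * (h * diff_flux xa h beta0 beta1 u0 j)
         - avgA xa h A u0 jm * (h * diff_flux xa h beta0 beta1 u0 jm))).
  rewrite (scheme_cell_mean h_gt0 tau_gt0 M_int u_scheme).
  rewrite (cell_mean_nodes j h_gt0 g11 M_int u0_Vh).
  rewrite /num_flux /lim_left /lim_right.
  rewrite -/jm -/jp jmS -/(P _) -/(P _) -/(S _) -/(S _) -/(G _).
  by field; rewrite gt_eqF.
rewrite !nodesE jmS -/jp -(omega_sum j h_gt0 g11 M_int).
apply/andP; split; lra.
Qed.
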